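(* For every real $C>0$ there exists a constant $D$ (depending only on $C$) with the following property. If $\lambda$ is a Young diagram with $n\geq 1$ boxes which has at most $C\sqrt{n}$ rows and at most $C\sqrt{n}$ columns, and $\pi\in S_n$ is a permutation, then $$|\chi^{\lambda}(\pi)| \leq \left( \frac{D \max\left(1,\frac{|\pi|^2}{n}\right)}{\sqrt{n}} \right)^{|\pi|}.$$
   Context: For a Young diagram $\lambda$ with $n$ boxes, $\rho^{\lambda}$ denotes the irreducible (complex) representation of the symmetric group $S_n$ indexed by $\lambda$, and $$\chi^{\lambda}(\pi)=\frac{\operatorname{Tr}\rho^{\lambda}(\pi)}{\operatorname{Tr}\rho^{\lambda}(e)},\qquad \pi\in S_n,$$ where $e$ is the identity. For a permutation $\pi$, $|\pi|$ denotes the minimal number of factors necessary to write $\pi$ as a product of transpositions (so $|e|=0$). *)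

(* Defs.v *)
From HB Require Import structures.
From mathcomp Require Import all_boot all_order all_algebra all_fingroup.
From mathcomp Require Import mxrepresentation.
From mathcomp Require Import complex.
From mathcomp Require Import reals.

Set Implicit Arguments.
Unset Strict Implicit.
Unset Printing Implicit Defensive.

Import GroupScope Order.TTheory GRing.Theory Num.Theory.
Local Open Scope ring_scope.

(* A Young diagram is given by its sequence of row lengths. *)
Record young_diagram (n : nat) := YoungDiagram {
  row_lengths :> seq nat;
  _ : sorted geq row_lengths && (0%N \notin row_lengths);
  _ : sumn row_lengths == n
}.

Definition num_rows n (la : young_diagram n) : nat := size la.

Definition num_columns n (la : young_diagram n) : nat := head 0%N la.

(* The boxes are numbered by 'I_n, row after row and from left to right in each
   row; box [k] lies in row [reshape_index la k] and in column
   [reshape_offset la k]. *)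
Definition row_stabilizer n (la : young_diagram n) : {set 'S_n} :=
  [set s : 'S_n | [forall k, reshape_index la (s k) == reshape_index la k]].

Definition column_stabilizer n (la : young_diagram n) : {set 'S_n} :=
  [set s : 'S_n | [forall k, reshape_offset la (s k) == reshape_offset la k]].

(* The group algebra F[S_n] is identified with row vectors, i.e. with the
   underlying space of [regular_repr], on which S_n acts by right
   multiplication; [gring_row (regular_repr F _ g)] is the basis vector of g. *)
Definition young_symmetrizer (F : fieldType) n (la : young_diagram n) :
    'rV[F]_#|[set: 'S_n]| :=
  \sum_(p in row_stabilizer la) \sum_(q in column_stabilizer la)
    (-1) ^+ q *: gring_row (regular_repr F [set: 'S_n] (p * q)%g).

(* rho^la: the action of S_n on the ideal of F[S_n] generated by the Young
   symmetrizer. In the group 'S_n, (s * t) applies s first, so that this right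
   ideal is the usual left ideal F[S_n]c for the composition of functions. Over
   a field of characteristic 0 this is the irreducible representation indexed
   by la, e.g. the trivial one for a single row. *)
Definition specht_repr (F : fieldType) n (la : young_diagram n) :=
  submod_repr (cyclic_mx_module (regular_repr F [set: 'S_n])
                 (young_symmetrizer F la)).

Definition normalized_character (R : realType) n (la : young_diagram n)
    (s : 'S_n) : R[i] :=
  \tr (specht_repr R[i] la s) / \tr (specht_repr R[i] la 1%g).

Definition transposition_product n (s : 'S_n) (m : nat) : bool :=
  [exists ts : m.-tuple ('I_n * 'I_n),
     all dpair ts && (s == \prod_(t <- ts) tperm t.1 t.2)%g].

Lemma ex_transposition_product n (s : 'S_n) :
  exists m, transposition_product s m.
Proof.
have [ts Ds dts] := prod_tpermP s; exists (size ts).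
by apply/existsP; exists (in_tuple ts); rewrite /= dts -Ds eqxx.
Qed.

Definition perm_length n (s : 'S_n) : nat :=
  ex_minn (ex_transposition_product s).

(* Main.v *)
Require Import Defs.
From mathcomp Require Import all_boot all_order all_algebra all_fingroup.
From mathcomp Require Import mxrepresentation complex reals.
From mathcomp Require Import ring zify.
Import Order.TTheory GRing.Theory Num.Theory.

Set Implicit Arguments.
Unset Strict Implicit.
Unset Printing Implicit Defensive.

(* Let [c] be the Young symmetrizer.  Since [c * c] is a nonzero multiple of
   [c], the normalized character at [s] is the average over [h] of the
   coefficient of [c] at [h s^-1 h^-1].  In absolute value it is thus at most
   the proportion of pairs made of a factorization [s = t u] and a bijection
   [h] onto the boxes for which the column of [h] is [t]-invariant and its row
   is [u]-invariant.  Such [t] and [u] live on the support of [s], of size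
   [k <= 2 |s|], and with rows and columns bounded by [C sqrt n] a given
   factorization contributes at most [(4 C^2)^k n^(-(|t|+|u|)/2)].

   It remains to bound the sum of [x^(|t|+|u|)] over the factorizations
   [s = t u] at [x = 1 / sqrt n].  At [x = 1 / k] it only depends on the
   conjugacy class of [s], so it is at most the sum over all pairs [(t, u)],
   which is exponential in [k], divided by the size of the class, which is at
   least [k! / k^(k - |s|)].  Passing from [1 / k] to [1 / sqrt n] costs the
   factor [max(1, k^2 / n)^|s|]. *)

Import GroupScope.

Lemma card_le_fibers (X Y : finType) (f : X -> Y) (A : {set X}) (M : nat) :
  {in A, forall x0, #|[set x in A | f x == f x0]| <= M} -> #|A| <= M * #|Y|.
Proof.
move=> hM; rewrite -sum1_card (partition_big f predT) //=.
rewrite mulnC -sum_nat_const; apply: leq_sum => y _.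
case: (set_0Vmem [set x in A | f x == y]) => [E|[x0]].
  by rewrite big1 // => x hx; have := in_set0 x; rewrite -E inE hx.
rewrite inE => /andP[x0A /eqP <-]; apply: leq_trans (hM x0 x0A).
by rewrite -sum1_card; apply/eq_leq/eq_bigl => x; rewrite inE.
Qed.

(** * Cycles of permutations, and counts of maps compatible with them *)

Section CycleLength.
Variable T : finType.
Implicit Types (s t : {perm T}) (K : {set T}).

(** The closed form of the transposition length; unlike [perm_length] it is easily tracked through
    products with a transposition. *)
Definition cycle_length s := #|T| - #|porbits s|.

Lemma card_porbits_le s : #|porbits s| <= #|T|.
Proof. by rewrite /porbits leq_imset_card. Qed.

Lemma porbit_fixed s x : s x = x -> porbit s x = [set x].
Proof.
move=> sx; apply/setP=> y; rewrite inE; apply/porbitP/eqP => [[i ->]|->].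
  by rewrite permX; elim: i => //= i ->.
by exists 0; rewrite perm1.
Qed.

(** The transposition inserts the fixed point [x] into the cycle of [y], so one cycle disappears. *)
Lemma cycle_length_tpermM s x y :
  s x = x -> x != y -> cycle_length (tperm x y * s) = (cycle_length s).+1.
Proof.
move=> sx nxy; have /= := porbits_mul_tperm s x y.
rewrite porbit_sym porbit_fixed // inE eq_sym nxy /= addn1 addn2 => -[] E.
by rewrite /cycle_length -E subnSK // E card_porbits_le.
Qed.

(** Cuts [x] out of its cycle, the inverse operation to the insertion of a fixed point. *)
Lemma tpermM_perm_on K x s :
  x \in K -> perm_on K s -> perm_on (K :\ x) (tperm x (s^-1 x) * s).
Proof.
move=> xK hs; apply/subsetP=> y; rewrite !inE; apply: contraNT.
rewrite negb_and negbK => /orP[/eqP->|yK]; first by rewrite permM tpermL permKV.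
rewrite permM tpermD ?(out_perm hs) //.
  by apply: contraNneq yK => <-.
apply: contraNneq yK => <-; rewrite (perm_closed _ (perm_onV hs)) //.
Qed.

Lemma perm_on_set0 s : perm_on set0 s -> s = 1.
Proof. by move=> h; apply: (perm_on_id h); rewrite cards0. Qed.

Lemma cycle_length1 : cycle_length 1 = 0.
Proof.
apply/eqP; rewrite subn_eq0 /porbits card_in_imset //.
move=> x y _ _; rewrite !porbit_fixed ?perm1 // => /setP/(_ x).
by rewrite !inE eqxx => /esym/eqP.
Qed.

Lemma porbit_conj s t x : porbit (s ^ t) (t x) = t @: porbit s x.
Proof.
apply/setP=> y; apply/porbitP/imsetP => [[i ->]|[z /porbitP[i ->] ->]].
  by exists ((s ^+ i) x); rewrite ?mem_porbit // -conjXg permJ.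
by exists i; rewrite -conjXg permJ.
Qed.

Lemma cycle_lengthJ s t : cycle_length (s ^ t) = cycle_length s.
Proof.
congr (_ - _).
have -> : porbits (s ^ t) = (fun A : {set T} => t @: A) @: porbits s.
  apply/setP=> A; apply/imsetP/imsetP => [[x _ ->]|[_ /imsetP[x _ ->] ->]].
    by exists (porbit s (t^-1 x)); rewrite ?imset_f // -porbit_conj permKV.
  by exists (t x); rewrite ?porbit_conj.
by rewrite card_imset //; apply/imset_inj/perm_inj.
Qed.

Definition cycles_in K s := [set c in porbits s | c \subset K].

Lemma porbit_sub K s x : perm_on K s -> x \in K -> porbit s x \subset K.
Proof.
move=> hs xK; apply/subsetP=> _ /porbitP[i ->].
by elim: i => [|i IH]; rewrite ?perm1 // expgSr permM perm_closed.
Qed.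

(** Points outside [K] are fixed, so each of them is a further cycle besides those inside [K]. *)
Lemma card_cycles_in K s :
  perm_on K s -> #|cycles_in K s| + cycle_length s <= #|K|.
Proof.
move=> hs; have fixK x : x \notin K -> porbit s x = [set x].
  by move=> xK; rewrite porbit_fixed // (out_perm hs).
have dis : [disjoint cycles_in K s & porbit s @: (~: K)].
  rewrite -setI_eq0; apply/eqP/setP=> c; rewrite !inE; apply/negbTE/negP.
  case/andP=> /andP[_ /subsetP cK] /imsetP[x]; rewrite inE => xK ce.
  by move: (cK x); rewrite ce porbit_id (negbTE xK) => /(_ isT).
have sub : cycles_in K s :|: (porbit s @: (~: K)) \subset porbits s.
  rewrite subUset; apply/andP; split; first by apply/subsetP=> c; rewrite inE => /andP[].
  by apply: imsetS; apply/subsetP.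
have := subset_leq_card sub; rewrite cardsU (disjoint_setI0 dis) cards0 subn0.
rewrite card_in_imset => [le|x y].
  rewrite /cycle_length -(cardsC K) addnBA; last by rewrite cardsC card_porbits_le.
  by rewrite leq_subLR addnCA [leqRHS]addnC leq_add2l.
by rewrite !inE => /fixK-> /fixK-> /setP/(_ x); rewrite !inE eqxx => /esym/eqP.
Qed.

Lemma cycle_transversal K s : perm_on K s ->
  exists rep : {c : {set T} | c \in cycles_in K s} -> T,
    (forall c, rep c \in K) /\
    {in K, forall x, exists c i, x = (s ^+ i) (rep c)}.
Proof.
move=> hs.
have /fin_all_exists[rep repP] :
    forall c : {c : {set T} | c \in cycles_in K s}, exists x, x \in val c.
  move=> [c /=]; rewrite inE => /andP[/imsetP[x _ ->] _].
  by exists x; apply: porbit_id.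
exists rep; split=> [[c cP]|x xK].
  by apply: (subsetP _ _ (repP _)) => /=; move: cP; rewrite inE => /andP[].
have cP : porbit s x \in cycles_in K s by rewrite inE imset_f ?porbit_sub.
pose c : {c : {set T} | c \in cycles_in K s} := Sub (porbit s x) cP.
exists c; have := repP c; rewrite /= porbit_sym.
by case/porbitP=> i ->; exists i.
Qed.

Lemma equivariant_eq (Y : Type) (f g : T -> Y) (h : Y -> Y) K s z i :
    perm_on K s -> {in K, forall x, f (s x) = h (f x)} ->
    {in K, forall x, g (s x) = h (g x)} -> z \in K -> f z = g z ->
  f ((s ^+ i) z) = g ((s ^+ i) z).
Proof.
move=> hs hf hg zK E; elim: i => [|i IH]; first by rewrite perm1.
have zi : (s ^+ i) z \in K by apply: (subsetP (porbit_sub hs zK)); apply: mem_porbit.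
by rewrite expgSr permM hf // hg // IH.
Qed.

(** As [g (s x) = t (g x)], a conjugator is determined on each cycle of [s] by the image of one
    representative. *)
Lemma card_conjugators K s t : perm_on K s ->
  #|[set g in Sym K | s ^ g == t]| <= #|K| ^ #|cycles_in K s|.
Proof.
move=> hs; have [rep [repK repP]] := cycle_transversal hs.
pose f (g : {perm T}) := [ffun c => g (rep c)].
have sj g : s ^ g = t -> {in K, forall x, g (s x) = t (g x)}.
  by move=> <- x _; rewrite permJ.
rewrite -(card_in_imset (f := f)) => [|g1 g2]; last first.
  rewrite !inE => /andP[g1K /eqP/sj h1] /andP[g2K /eqP/sj h2] /ffunP E.
  apply/permP=> x; have [/repP[c [i ->]]|xK] := boolP (x \in K).
    by apply: (equivariant_eq _ hs h1 h2); have := E c; rewrite ?ffunE.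
  by rewrite !(out_perm _ xK).
have -> : #|cycles_in K s| = #|{: {c : {set T} | c \in cycles_in K s}}|.
  by rewrite card_sig; apply: eq_card => x; rewrite !inE.
rewrite -card_ffun_on; apply/subset_leq_card/subsetP => _ /imsetP[g + ->].
rewrite !inE => /andP[gK _]; apply/ffun_onP => c.
by rewrite ffunE perm_closed.
Qed.

(** The [r]-labels at representatives of the cycles of [s] and the [c]-labels at those of [t]
    determine both labels of [h x] for [x] in [K], hence [h] on [K]; the factorial counts the
    freedom outside [K]. *)
Lemma card_invariant_labelings (A B : finType) (r : T -> A) (c : T -> B) K s t :
    injective (fun x => (r x, c x)) -> perm_on K s -> perm_on K t ->
  #|[set h : {perm T} | [forall x, (r (h (s x)) == r (h x)) &&
                                   (c (h (t x)) == c (h x))]]|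
    <= #|~: K|`! * (#|A| ^ #|cycles_in K s| * #|B| ^ #|cycles_in K t|).
Proof.
move=> rc_inj hs ht; set H := [set h | _].
have [u [uK uP]] := cycle_transversal hs; have [v [vK vP]] := cycle_transversal ht.
pose f (h : {perm T}) := ([ffun i => r (h (u i))], [ffun j => c (h (v j))]).
have cards : (#|A| ^ #|cycles_in K s| * #|B| ^ #|cycles_in K t|)%N =
    #|{: {ffun {c | c \in cycles_in K s} -> A} * {ffun {c | c \in cycles_in K t} -> B}}|.
  rewrite card_prod !card_ffun !card_sig.
  by congr (_ ^ _ * _ ^ _)%N; apply: eq_card => x; rewrite !inE.
have HP h : h \in H -> {in K, forall x, r (h (s x)) = r (h x)} /\
                       {in K, forall x, c (h (t x)) = c (h x)}.
  by rewrite inE => /forallP hh; split=> x _; have /andP[/eqP ? /eqP ?] := hh x.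
rewrite cards; apply: (card_le_fibers (f := f)) => h0 /HP[r0 c0].
(* All [h] with the data of [h0] agree with it on [K], so they lie in one coset of the permutations
   of the complement. *)
rewrite -card_Sym -(card_rcoset (Sym (~: K)) h0); apply/subset_leq_card/subsetP => h.
rewrite inE => /andP[/HP[r1 c1] /eqP[/ffunP Er /ffunP Ec]].
rewrite mem_rcoset inE; apply/subsetP=> x; rewrite !inE; apply: contraNN => xK.
rewrite permM -(inj_eq (@perm_inj _ h0)) permKV; apply/eqP/rc_inj; congr (_, _).
  have [i [m ->]] := uP x xK.
  apply: (equivariant_eq (f := r \o h) (g := r \o h0) (h := id) _ hs) => //=.
  by have := Er i; rewrite !ffunE.
have [i [m ->]] := vP x xK.
apply: (equivariant_eq (f := c \o h) (g := c \o h0) (h := id) _ ht) => //=.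
by have := Ec i; rewrite !ffunE.
Qed.
End CycleLength.

(** * Transposition length compared with cycle length and support *)

Section PermLength.
Variable n : nat.
Implicit Types s t : 'S_n.

Lemma perm_length_leP s m :
  reflect (exists ts : seq ('I_n * 'I_n), [/\ size ts = m, all dpair ts &
             s = \prod_(t <- ts) tperm t.1 t.2])
    (transposition_product s m).
Proof.
apply: (iffP existsP) => [[ts /andP[d /eqP ->]]|[ts [sz d ->]]].
  by exists ts; rewrite size_tuple.
by exists (Tuple (introT eqP sz)); rewrite d eqxx.
Qed.

Lemma perm_length_le s ts : all dpair ts -> s = \prod_(t <- ts) tperm t.1 t.2 ->
  perm_length s <= size ts.
Proof.
move=> d e; rewrite /perm_length; case: ex_minnP => m _; apply.
by apply/perm_length_leP; exists ts.
Qed.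

Lemma perm_lengthP s : exists ts : seq ('I_n * 'I_n),
  [/\ size ts = perm_length s, all dpair ts & s = \prod_(t <- ts) tperm t.1 t.2].
Proof. by apply/perm_length_leP; rewrite /perm_length; case: ex_minnP. Qed.

Lemma perm_lengthM s t : perm_length (s * t) <= perm_length s + perm_length t.
Proof.
have [u [<- du us]] := perm_lengthP s; have [v [<- dv vt]] := perm_lengthP t.
by rewrite -size_cat perm_length_le ?all_cat ?du // big_cat /= -us -vt.
Qed.

(** Induction on the number of moved points: cutting a moved [x] out of its cycle costs one
    transposition and lowers [cycle_length] by one. *)
Lemma perm_length_le_cycle_length s : perm_length s <= cycle_length s.
Proof.
have [m] := ubnP #|[set x | s x != x]|; elim: m s => // m IH s lm.
have [/setP s1|[x]] := set_0Vmem [set x | s x != x].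
  suff -> : s = 1 by rewrite (leq_trans (@perm_length_le 1 [::] _ _)) ?big_nil.
  by apply/permP=> x; have := s1 x; rewrite !inE perm1 => /negbFE/eqP.
rewrite inE => sx; pose y := s^-1 x; pose s' := tperm x y * s.
have nxy : x != y by rewrite -(inj_eq (@perm_inj _ s)) permKV.
have E : s = tperm x y * s' by rewrite mulgA tperm2 mul1g.
have hs : perm_on [set z | s z != z] s by apply/subsetP=> z; rewrite !inE.
have hs' : perm_on ([set z | s z != z] :\ x) s' by rewrite tpermM_perm_on ?inE.
have s'x : s' x = x by rewrite (out_perm hs') // !inE eqxx.
rewrite E cycle_length_tpermM //; apply: leq_trans (perm_lengthM _ _) _.
rewrite -add1n leq_add //.
  by rewrite (leq_trans (@perm_length_le _ [:: (x, y)] _ _)) ?big_seq1 //= /dpair /= nxy.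
rewrite ltnS in lm; apply: IH; apply: leq_trans lm; rewrite [leqRHS](cardsD1 x) inE sx ltnS.
by apply: subset_leq_card; apply/subsetP=> z; rewrite inE => /(subsetP hs').
Qed.

Lemma card_support_le s : #|[set x | s x != x]| <= 2 * perm_length s.
Proof.
have [ts [<- _ ->]] := perm_lengthP s; elim: ts => [|[a b] ts IH].
  by rewrite big_nil eq_card0 // => x; rewrite inE perm1 eqxx.
rewrite big_cons /= mulnS; set u := \prod_(t <- ts) _ in IH *.
apply: leq_trans (leq_add (_ : #|[set a; b]| <= 2) IH); last by rewrite cards2; case: eqP.
apply: leq_trans (leq_card_setU _ _); apply/subset_leq_card/subsetP => x.
rewrite !inE -orbA permM; case: tpermP => [->|->|/eqP/negbTE-> /eqP/negbTE-> //].
  by rewrite eqxx.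
by rewrite eqxx orbT.
Qed.

End PermLength.

(** * Boxes of a Young diagram, and permutations sending each row to distinct columns *)

Section Boxes.
Variables (n : nat) (la : young_diagram n).

Lemma sumn_rows : sumn la = n.
Proof. by case: la => rows /= _ /eqP. Qed.

Lemma row_of_subproof (k : 'I_n) : reshape_index la k < num_rows la.
Proof. by rewrite reshape_indexP // sumn_rows. Qed.

Lemma col_of_subproof (k : 'I_n) : reshape_offset la k < num_columns la.
Proof.
apply: leq_trans (reshape_offsetP _) _; first by rewrite sumn_rows.
have := row_of_subproof k; rewrite /num_rows /num_columns; set i := reshape_index _ _.
case: la i => -[//|a rows] /= /andP[srt _] _ [//|i] /= hi.
have tr : transitive geq by move=> x y z /= h1 h2; apply: leq_trans h1.
by move/(order_path_min tr)/allP: srt; apply; apply: mem_nth.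
Qed.

Definition row_of k : 'I_(num_rows la) := Ordinal (row_of_subproof k).
Definition col_of k : 'I_(num_columns la) := Ordinal (col_of_subproof k).

Lemma box_inj : injective (fun k => (row_of k, col_of k)).
Proof.
move=> k l [er ec]; apply: ord_inj.
by rewrite -(reshape_indexK la k) -(reshape_indexK la l) er ec.
Qed.

Lemma exists_box (a : 'I_(num_rows la)) i : i < nth 0 la a ->
  exists k, row_of k = a /\ col_of k = i :> nat.
Proof.
move=> hi; have lt : flatten_index la a i < n.
  by apply: leq_trans (flatten_indexP hi) _; rewrite sumn_rows.
exists (Ordinal lt); split; last exact: flatten_indexKr.
by apply: ord_inj => /=; exact: flatten_indexKl.
Qed.

Lemma row_stabilizerP (s : 'S_n) :
  reflect (forall k, row_of (s k) = row_of k) (s \in row_stabilizer la).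
Proof.
rewrite inE; apply: (iffP forallP) => h k; last by have /(congr1 val)/= -> := h k.
by apply: ord_inj; apply/eqP/h.
Qed.

Lemma column_stabilizerP (s : 'S_n) :
  reflect (forall k, col_of (s k) = col_of k) (s \in column_stabilizer la).
Proof.
rewrite inE; apply: (iffP forallP) => h k; last by have /(congr1 val)/= -> := h k.
by apply: ord_inj; apply/eqP/h.
Qed.

Section Straighten.
Variable s : 'S_n.
Hypothesis sP : forall k l, row_of k = row_of l -> col_of (s k) = col_of (s l) -> k = l.

(* For every [j], at most as many boxes of row [a] go under [s] to the first
   [j] columns as there are boxes of row [a] in these columns; summed over the
   rows both counts agree, so equality holds in each row. *)
Lemma straight_col_lt k : col_of (s k) < nth 0 la (row_of k).
Proof.
pose a := row_of k; pose j := nth 0 la a.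
pose L b := #|[set l | (row_of l == b) && (col_of (s l) < j)]|.
pose M b := #|[set l | (row_of l == b) && (col_of l < j)]|.
have leLM b : L b <= M b.
  have [lej|ltj] := leqP j (nth 0 la b); last first.
    apply/subset_leq_card/subsetP => l; rewrite !inE => /andP[/eqP e _]; rewrite e eqxx /=.
    apply: ltn_trans ltj; rewrite -e.
    by apply: reshape_offsetP; rewrite sumn_rows.
  have /fin_all_exists[f fP] : forall l, exists m, row_of l = b ->
      col_of (s l) < j -> row_of m = b /\ col_of m = col_of (s l).
    move=> l; have [lt|ge] := ltnP (col_of (s l)) j; last by exists l; lia.
    have [m [rm cm]] := exists_box (leq_trans lt lej).
    by exists m => _ _; split=> //; apply: ord_inj.
  rewrite /L -(card_in_imset (f := f)) => [|l m]; last first.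
    rewrite !inE => /andP[/eqP rl cl] /andP[/eqP rm cm] E.
    apply: sP; first by rewrite rl rm.
    by rewrite -(fP l rl cl).2 -(fP m rm cm).2 E.
  apply/subset_leq_card/subsetP => _ /imsetP[l + ->].
  by rewrite !inE => /andP[/eqP rl cl]; have [-> ->] := fP l rl cl; rewrite eqxx.
have sumE (u : 'I_n -> 'I_n) :
    \sum_b #|[set l | (row_of l == b) && (col_of (u l) < j)]| =
    #|[set l | col_of (u l) < j]|.
  rewrite -sum1_card (partition_big row_of predT) //=; apply: eq_bigr => b _.
  by rewrite -sum1_card; apply: eq_bigl => l; rewrite !inE andbC.
have LM : L a = M a.
  have E : \sum_b L b = \sum_b M b.
    rewrite (sumE s) (sumE id) -(card_imset _ (@perm_inj _ s)).
    apply: eq_card => l; rewrite inE; apply/imsetP/idP => [[m + ->]|hl].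
      by rewrite inE.
    by exists (s^-1 l); rewrite ?inE permKV.
  have : \sum_b (M b - L b) = 0 by rewrite sumnB // E subnn.
  by move/eqP; rewrite sum_nat_eq0 => /forallP/(_ a); have := leLM a; lia.
have sub : [set l | (row_of l == a) && (col_of (s l) < j)] \subset [set l | row_of l == a].
  by apply/subsetP=> l; rewrite !inE => /andP[].
have /setP/(_ k) : [set l | (row_of l == a) && (col_of (s l) < j)] = [set l | row_of l == a].
  apply/eqP; rewrite -(geq_leqif (subset_leqif_cards sub)) -/(L a) LM.
  apply/subset_leq_card/subsetP => l; rewrite !inE => /eqP la_; rewrite la_ eqxx /=.
  by rewrite /j -la_; apply: reshape_offsetP; rewrite sumn_rows.
by rewrite !inE eqxx.
Qed.

(** The classical combinatorial lemma behind Young symmetrizers: [p] moves each box inside its row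
    to the column of its image under [s]. That place exists by [straight_col_lt], and [p] is
    injective by [sP]. *)
Lemma straighten : exists p q,
  [/\ p \in row_stabilizer la, q \in column_stabilizer la & s = p * q].
Proof.
have /fin_all_exists[f fP] : forall k, exists l,
    row_of l = row_of k /\ col_of l = col_of (s k).
  move=> k; have [l [rl cl]] := exists_box (straight_col_lt k).
  by exists l; split=> //; apply: ord_inj.
have f_inj : injective f.
  by move=> k l E; apply: sP; [rewrite -(fP k).1 E (fP l).1 | rewrite -(fP k).2 E (fP l).2].
exists (perm f_inj), ((perm f_inj)^-1 * s); split; last by rewrite mulKVg.
  by apply/row_stabilizerP=> k; rewrite permE (fP k).1.
apply/column_stabilizerP=> k; rewrite permM.
by rewrite -{2}[k](permKV (perm f_inj)) permE (fP _).2.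
Qed.

End Straighten.
End Boxes.

Local Open Scope ring_scope.

(** * Sums weighted by cycle length over the symmetric group of a set *)

Section SymSums.
Variables (R : realFieldType) (T : finType).
Implicit Types (s t : {perm T}) (K : {set T}).

(** Sorting by the preimage of [x] and cutting [x] out of its cycle gives a recursion on the size of
    [K]. *)
Lemma sum_Sym_rem (F : {perm T} -> R) K x : x \in K ->
  \sum_(s in Sym K) F s =
  \sum_(y in K) \sum_(s in Sym (K :\ x)) F (tperm x y * s)%g.
Proof.
move=> xK; rewrite (partition_big (fun s : {perm T} => (s^-1)%g x) (mem K)) /=; last first.
  by move=> s; rewrite inE => hs; rewrite perm_closed ?perm_onV.
apply: eq_bigr => y yK.
rewrite (reindex_onto (fun s => (tperm x y * s)%g) (fun s => (tperm x y * s)%g)) /=; last first.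
  by move=> s _; rewrite mulgA tperm2 mul1g.
apply: eq_bigl => s; rewrite !inE mulgA tperm2 mul1g eqxx andbT.
apply/andP/idP => [[h /eqP e]|h].
  have := tpermM_perm_on xK h; rewrite e mulgA tperm2 mul1g //.
have sx : s x = x by rewrite (out_perm h) // !inE eqxx.
have sVx : (s^-1)%g x = x by rewrite -{1}sx permK.
split; last by rewrite invMg tpermV permM sVx tpermL.
apply: perm_onM; last by apply: subset_trans h (subsetDl _ _).
apply: subset_trans (tperm_on x y) _; apply/subsetP=> z.
by rewrite !inE => /orP[/eqP->|/eqP->].
Qed.

(** The recursion evaluates the sum as the product of the [1 + i * y] for [i < #|K|]; each factor is
    enlarged to [1 + #|K| * y]. *)
Lemma sum_cycle_length_le (y : R) K : 0 <= y ->
  \sum_(s in Sym K) y ^+ cycle_length s <= (1 + #|K|%:R * y) ^+ #|K|.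
Proof.
move=> y0; suff H n : (n <= #|K|)%N -> forall J : {set T}, #|J| = n ->
    \sum_(s in Sym J) y ^+ cycle_length s <= (1 + #|K|%:R * y) ^+ n.
  exact: H (leqnn _) _ erefl.
elim: n => [_ J /eqP|n IH ltn J cJ].
  rewrite cards_eq0 => /eqP->; rewrite expr0 (big_pred1 1%g) => [|s].
    by rewrite cycle_length1 expr0.
  rewrite inE; apply/idP/eqP => [/perm_on_set0//|->]; exact: perm_on1.
have /set0Pn[x xJ] : J != set0 by rewrite -card_gt0 cJ.
have cJx : #|J :\ x| = n by move: cJ; rewrite (cardsD1 x) xJ => -[].
have {}IH := IH (ltnW ltn) _ cJx; set S := \sum_(s in Sym (J :\ x)) _ in IH.
have S0 : 0 <= S by apply: sumr_ge0 => s _; rewrite exprn_ge0.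
(* The permutations fixing [x] give [S]; each of the [n] other preimages of [x] gives [y * S]. *)
rewrite (sum_Sym_rem _ xJ) (big_setD1 x) //= tperm1.
under [X in X + _ <= _]eq_bigr do rewrite mul1g.
rewrite -/S (eq_bigr (fun=> y * S)) => [|z zJ]; last first.
  rewrite mulr_sumr; apply: eq_bigr => s; rewrite inE => hs; rewrite -exprS.
  rewrite cycle_length_tpermM ?(out_perm hs) ?inE ?eqxx //.
  by move: zJ; rewrite !inE eq_sym => /andP[].
rewrite sumr_const cJx -[(y * S) *+ n]mulr_natl exprS mulrA -{1}[S]mul1r -mulrDl.
have k0 : 0 <= 1 + #|K|%:R * y by rewrite addr_ge0 ?mulr_ge0.
apply: le_trans (ler_wpM2l k0 IH); rewrite ler_wpM2r // lerD2l ler_wpM2r //.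
by rewrite ler_nat ltnW.
Qed.

(* The factorizations of [s] are conjugated by all the permutations [g] of
   [K]: each [s ^ g] arises from at most [#|K| ^ #|cycles_in K s|] of them. *)
Lemma sum_factorizations_le (y : R) K s : 0 <= y -> perm_on K s ->
  #|K|`!%:R * \sum_(t in Sym K) y ^+ (cycle_length t + cycle_length (t^-1 * s)%g)
    <= (#|K| ^ #|cycles_in K s|)%:R * (1 + #|K|%:R * y) ^+ (#|K| * 2).
Proof.
move=> y0 hs.
pose w u := \sum_(t in Sym K) y ^+ (cycle_length t + cycle_length (t^-1 * u)%g).
have w0 u : 0 <= w u by apply: sumr_ge0 => t _; rewrite exprn_ge0.
have wJ g : g \in Sym K -> w (s ^ g)%g = w s.
  move=> gK; rewrite /w (reindex_inj (conjg_inj g)) /=.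
  apply: eq_big => [t|t _]; first by rewrite memJ_norm // (subsetP (normG _)).
  by rewrite -conjVg -conjMg !cycle_lengthJ.
have -> : #|K|`!%:R * w s = \sum_(g in Sym K) w (s ^ g)%g.
  by rewrite (eq_bigr _ wJ) sumr_const card_Sym mulr_natl.
rewrite (partition_big (fun g => (s ^ g)%g) (mem (Sym K))) /=; last first.
  by move=> g gK; rewrite groupJ // inE.
have -> : (1 + #|K|%:R * y) ^+ (#|K| * 2) = ((1 + #|K|%:R * y) ^+ #|K|) ^+ 2.
  by rewrite exprM.
apply: (@le_trans _ _ (\sum_(u in Sym K) (#|K| ^ #|cycles_in K s|)%:R * w u)).
  apply: ler_sum => u uK.
  rewrite (eq_bigr (fun=> w u)) => [|g /andP[_ /eqP->] //].
  rewrite sumr_const -[w u *+ _]mulr_natl ler_wpM2r // ler_nat.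
  apply: leq_trans (card_conjugators u hs).
  by apply/eq_leq/eq_card => g; rewrite !inE unfold_in inE.
(* With [u] free in [Sym K], replacing [u] by [t * u] separates the double sum into a square. *)
rewrite -mulr_sumr ler_wpM2l // /w exchange_big /=.
rewrite (eq_bigr (fun t => y ^+ cycle_length t *
   \sum_(u in Sym K) y ^+ cycle_length u)) => [|t tK].
  rewrite -mulr_suml -expr2 lerXn2r ?nnegrE ?sum_cycle_length_le //.
    by apply: sumr_ge0 => t _; rewrite exprn_ge0.
  by rewrite exprn_ge0 // addr_ge0 ?mulr_ge0.
rewrite mulr_sumr (reindex_inj (mulgI t)) /=.
apply: eq_big => [u|u _]; first by rewrite groupMl.
by rewrite mulKg exprD.
Qed.

End SymSums.

(** * Traces on a submodule, from an endomorphism that is scalar there *)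

Section SubmodTrace.
Variables (F : fieldType) (gT : finGroupType) (G : {group gT}) (n : nat).
Variables (rG : mx_representation F G n) (U : 'M[F]_n) (modU : mxmodule rG U).

(** [L] factors as [M *m B] through a basis [B] of [U]. Being [k] on [U], it satisfies
    [B *m M = k%:M], and cyclicity of the trace moves the computation to [U]. *)
Lemma mxtrace_submod_repr (L : 'M[F]_n) (k : F) x : x \in G ->
    (L <= U)%MS -> (U <= kermx (L - k%:M))%MS ->
  \tr (rG x *m L) = k * \tr (submod_repr modU x).
Proof.
move=> Gx LU /sub_kermxP UL; pose B := val_submod (1%:M : 'M_(\rank U)).
have BL : B *m L = k *: B.
  have /submxP[A ->] : (B <= U)%MS by apply: val_submodP.
  apply/eqP; rewrite -subr_eq0 -mul_mx_scalar -mulmxBr -mulmxA.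
  by rewrite UL mulmx0.
have [M LE] : exists M, L = M *m B.
  by apply/submxP; apply: submx_trans LU _; rewrite val_submod1.
have BM : B *m M = k%:M.
  apply: (@val_submod_inj _ _ U); rewrite [LHS]val_submodE [RHS]val_submodE -/B -mulmxA -LE BL.
  by rewrite mul_scalar_mx.
have BG : B *m rG x = submod_repr modU x *m B.
  by rewrite -(val_submodJ modU) // mul1mx [LHS]val_submodE.
rewrite LE mulmxA mxtrace_mulC mulmxA BG -mulmxA BM mul_mx_scalar linearZ //.
Qed.
End SubmodTrace.

(** * The Young symmetrizer and the character of the ideal it generates *)

Section YoungSymmetrizer.
Variables (F : numFieldType) (n : nat) (la : young_diagram n).

(** The Young symmetrizer as a function on the group ([gring_coef_young]). The two stabilizers meet
    trivially, so at most one term is nonzero. *)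
Definition young_coef (x : 'S_n) : F :=
  \sum_(p in row_stabilizer la) \sum_(q in column_stabilizer la)
    (-1) ^+ q *+ (p * q == x)%g.

Lemma row_stabilizer1 : 1%g \in row_stabilizer la.
Proof. by apply/row_stabilizerP=> k; rewrite perm1. Qed.

Lemma column_stabilizer1 : 1%g \in column_stabilizer la.
Proof. by apply/column_stabilizerP=> k; rewrite perm1. Qed.

Lemma row_stabilizerM p p' : p \in row_stabilizer la ->
  (p * p' \in row_stabilizer la)%g = (p' \in row_stabilizer la).
Proof.
move=> /row_stabilizerP hp; apply/row_stabilizerP/row_stabilizerP => h k.
  by rewrite -[k](permKV p) -permM h hp.
by rewrite permM h hp.
Qed.

Lemma column_stabilizerM q q' : q' \in column_stabilizer la ->
  (q * q' \in column_stabilizer la)%g = (q \in column_stabilizer la).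
Proof.
move=> /column_stabilizerP hq; apply/column_stabilizerP/column_stabilizerP => h k.
  by rewrite -hq -permM h.
by rewrite permM hq h.
Qed.

Lemma stabilizer_trivial p q : p \in row_stabilizer la ->
  q \in column_stabilizer la -> (p * q = 1)%g -> p = 1%g /\ q = 1%g.
Proof.
move=> /row_stabilizerP hp /column_stabilizerP hq E.
suff p1 : p = 1%g by move: E; rewrite p1 mul1g.
apply/permP=> k; rewrite perm1; apply: (@box_inj _ la); congr (_, _) => //.
by rewrite -hq -permM E perm1.
Qed.

Definition young_biinvariant (f : 'S_n -> F) :=
  (forall p x, p \in row_stabilizer la -> f (p * x)%g = f x) /\
  (forall q x, q \in column_stabilizer la -> f (x * q)%g = (-1) ^+ q * f x).

Lemma young_coef_biinvariant : young_biinvariant young_coef.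
Proof.
split=> [p x hp|q x hq].
  rewrite /young_coef (reindex_inj (mulgI p)) /=; apply: eq_big => [p'|p' _].
    by rewrite row_stabilizerM.
  by apply: eq_bigr => q _; rewrite -mulgA (inj_eq (mulgI p)).
rewrite /young_coef mulr_sumr; apply: eq_bigr => p _.
rewrite mulr_sumr (reindex_inj (mulIg q)) /=; apply: eq_big => [q'|q' _].
  by rewrite column_stabilizerM.
by rewrite mulgA (inj_eq (mulIg q)) odd_permM signr_addb mulrnAr mulrC.
Qed.

Lemma young_coef1 : young_coef 1 = 1.
Proof.
rewrite /young_coef (bigD1 1%g) ?row_stabilizer1 //= (bigD1 1%g) ?column_stabilizer1 //=.
rewrite mulg1 eqxx odd_perm1 expr0 big1 => [|q /andP[hq nq]]; last first.
  case: (@eqP _ (1 * q)%g 1%g) => // /(stabilizer_trivial row_stabilizer1 hq)[_ e].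
  by rewrite e eqxx in nq.
rewrite addr0 big1 ?addr0 // => p /andP[hp np]; apply: big1 => q hq.
case: (@eqP _ (p * q)%g 1%g) => // /(stabilizer_trivial hp hq)[e _].
by rewrite e eqxx in np.
Qed.

(** By [straighten] such a function can only be nonzero at products of a row and a column
    permutation, where the symmetry reduces its value to that at 1. *)
Lemma young_biinvariant_eq f x : young_biinvariant f -> f x = f 1%g * young_coef x.
Proof.
move=> hf; have neg g y : young_biinvariant g -> (forall p q,
    p \in row_stabilizer la -> q \in column_stabilizer la -> y <> p * q)%g -> g y = 0.
  (* If [y] sends two boxes of a row into one column, their transposition to the left of [y] equals
     a column transposition to its right, so [g y = - g y]. *)
  move=> [gl gr] hy; have [/existsP[k /existsP[l]]|] := boolP [exists k, exists l,
      [&& k != l, row_of la k == row_of la l & col_of la (y k) == col_of la (y l)]].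
    case/and3P=> kl /eqP rkl /eqP ckl.
    have hp : tperm k l \in row_stabilizer la.
      by apply/row_stabilizerP=> i; case: tpermP => [->|->|//].
    have hq : (tperm k l ^ y)%g \in column_stabilizer la.
      by rewrite tpermJ; apply/column_stabilizerP=> i; case: tpermP => [->|->|//].
    have /eqP := gl _ y hp; rewrite conjgC gr // tpermJ odd_tperm.
    rewrite (inj_eq (@perm_inj _ y)) kl expr1 mulN1r -subr_eq0 -opprD oppr_eq0.
    by rewrite -mulr2n mulrn_eq0 => /eqP.
  move=> /existsPn h; have [|p [q [hp hq E]]] := @straighten _ la y; last by case: (hy p q).
  move=> k l /eqP rkl /eqP ckl; have /existsPn/(_ l) := h k.
  by rewrite rkl ckl /= !andbT negbK => /eqP.
have [|] := boolP [exists p in row_stabilizer la, exists q in column_stabilizer la,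
   x == p * q]%g; last first.
  move=> /exists_inP h; have hx p q : p \in row_stabilizer la ->
      q \in column_stabilizer la -> x <> (p * q)%g.
    by move=> hp hq E; case: h; exists p => //; apply/exists_inP; exists q; rewrite ?E.
  by rewrite !(neg _ _ _ hx) ?mulr0 //; apply: young_coef_biinvariant.
case/exists_inP=> p hp /exists_inP[q hq /eqP ->].
have [fl fr] := hf; have [cl cr] := young_coef_biinvariant.
by rewrite fl // cl // -[q]mul1g fr // cr // young_coef1 mulr1 mulrC.
Qed.

Let G := [set: 'S_n]%G.
Let aG := regular_repr F G.
Let c := young_symmetrizer F la.

Definition gring_coef (v : 'rV[F]_#|[set: 'S_n]|) (x : 'S_n) := v 0 (gring_index G x).

Lemma gring_coef_inj v w : gring_coef v =1 gring_coef w -> v = w.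
Proof.
move=> E; apply/rowP=> i; have := E (enum_val i).
by rewrite /gring_coef gring_valK.
Qed.

Lemma gring_coef_mul v g x : gring_coef (v *m aG g) x = gring_coef v (x * g^-1)%g.
Proof.
rewrite /gring_coef mxE (bigD1 (gring_index G (x * g^-1)%g)) //= big1 => [|j nj].
  by rewrite !mxE gring_indexK ?inE // mulgKV !eqxx mulr1 addr0.
rewrite !mxE eqxx /=; case: eqP => [/= E|]; last by rewrite mulr0.
case/eqP: nj; rewrite -[j](@gring_valK _ G).
have -> : x = (enum_val j * g)%g; last by rewrite mulgK.
by rewrite -[LHS](@gring_indexK _ G) ?inE // E gring_indexK ?inE.
Qed.

Lemma gring_coef_young x : gring_coef c x = young_coef x.
Proof.
rewrite /gring_coef /c /young_symmetrizer summxE; apply: eq_bigr => p _.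
rewrite summxE; apply: eq_bigr => q _; rewrite !mxE.
rewrite gring_indexK ?inE // mul1g eqxx /= eq_sym.
by rewrite (inj_in_eq (can_in_inj (@gring_indexK _ G))) ?inE // mulr_natr.
Qed.

(** Left multiplication by [c] in the group algebra; it commutes with the module action, which is on
    the right. *)
Definition young_left_mul := \matrix_(i < #|G|) (c *m aG (enum_val i)%g).
Local Notation L := young_left_mul.

Lemma gring_row_left_mul g : gring_row (aG g) *m L = c *m aG g.
Proof. by rewrite /gring_row rowK gring_indexK ?inE // mul1g -rowE rowK gring_indexK ?inE. Qed.

Lemma young_left_mul_cent : centgmx aG L.
Proof.
apply/centgmxP=> g _; apply/row_matrixP=> i.
rewrite !row_mul [row i L]rowK [row i (aG g)]rowK -rowE rowK gring_indexK ?inE //.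
by rewrite repr_mxM ?inE // mulmxA.
Qed.

Lemma young_symmetrizer_left_mul :
  c *m L = \sum_(p in row_stabilizer la) \sum_(q in column_stabilizer la)
    (-1) ^+ q *: (c *m aG (p * q)%g).
Proof.
rewrite {1}/c /young_symmetrizer mulmx_suml; apply: eq_bigr => p _.
rewrite mulmx_suml; apply: eq_bigr => q _.
by rewrite -scalemxAl gring_row_left_mul.
Qed.

(** The product of [c] with itself keeps the row symmetry of its left factor and the column symmetry
    of its right factor, so [young_biinvariant_eq] applies. *)
Lemma young_symmetrizer_square : c *m L = gring_coef (c *m L) 1%g *: c.
Proof.
apply: gring_coef_inj => x; rewrite [RHS]mxE -/(gring_coef c x) gring_coef_young.
apply: young_biinvariant_eq; rewrite young_symmetrizer_left_mul.
have E y : gring_coef (\sum_(p in row_stabilizer la) \sum_(q in column_stabilizer la)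
    (-1) ^+ q *: (c *m aG (p * q)%g)) y = \sum_(p in row_stabilizer la)
    \sum_(q in column_stabilizer la) (-1) ^+ q * young_coef (y * q^-1 * p^-1)%g.
  rewrite /gring_coef summxE; apply: eq_bigr => p _; rewrite summxE; apply: eq_bigr => q _.
  by rewrite mxE -/(gring_coef _ y) gring_coef_mul gring_coef_young invMg mulgA.
have [cl cr] := young_coef_biinvariant.
split=> [p y hp|q y hq]; rewrite !E.
  by apply: eq_bigr => p' _; apply: eq_bigr => q' _; rewrite -!mulgA cl.
rewrite mulr_sumr; apply: eq_bigr => p _.
rewrite mulr_sumr (reindex_inj (mulIg q)) /=; apply: eq_big => [q'|q' _].
  by rewrite column_stabilizerM.
rewrite odd_permM signr_addb invMg [(y * q * _)%g]mulgA mulgK mulrA.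
by rewrite [(-1) ^+ q * _]mulrC.
Qed.

Lemma trace_left_mul s :
  \tr (aG s *m L) = \sum_(h : 'S_n) young_coef (h * s^-1 * h^-1)%g.
Proof.
rewrite /mxtrace (reindex (gring_index G)) /=; last first.
  by exists enum_val => x _; rewrite ?gring_valK ?gring_indexK ?inE.
apply: eq_bigr => h _.
have -> : (aG s *m L) (gring_index G h) (gring_index G h) =
    row (gring_index G h) (aG s *m L) 0 (gring_index G h) by rewrite [RHS]mxE.
rewrite row_mul [row _ (aG s)]rowK -rowE rowK !gring_indexK ?inE //.
by rewrite -/(gring_coef _ h) gring_coef_mul gring_coef_young invMg mulgA.
Qed.

(** [L] maps the algebra into the ideal of [c] and is a scalar there, so the trace of [s] followed
    by [L] is that scalar times the trace on the ideal. The scalar is nonzero because the sum at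
    [s = 1] is [n!]. *)
Lemma specht_character : exists2 k : F, k != 0 &
  forall s, \sum_(h : 'S_n) young_coef (h * s^-1 * h^-1)%g = k * \tr (specht_repr F la s).
Proof.
have tr s : \sum_(h : 'S_n) young_coef (h * s^-1 * h^-1)%g =
    gring_coef (c *m L) 1%g * \tr (specht_repr F la s).
  rewrite -trace_left_mul /specht_repr; apply: mxtrace_submod_repr; first by rewrite inE.
    apply/row_subP=> i; rewrite rowK.
    by apply: (mxmodule_trans (cyclic_mx_module _ _)); rewrite ?inE ?cyclic_mx_id.
  (* The vectors on which [L] acts by this scalar form a submodule containing [c], hence contain the
     ideal it generates. *)
  apply: cyclic_mx_sub.
    apply: kermx_centg_module; apply/centgmxP=> g gG.
    by rewrite mulmxBl mulmxBr (centgmxP young_left_mul_cent) // scalar_mxC.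
  by apply/sub_kermxP; rewrite mulmxBr mul_mx_scalar -young_symmetrizer_square subrr.
exists (gring_coef (c *m L) 1%g) => //; apply/negP=> /eqP k0.
have := tr 1%g; rewrite k0 mul0r; under eq_bigr do rewrite invg1 mulg1 mulgV young_coef1.
by rewrite sumr_const card_Sn => /eqP; rewrite pnatr_eq0 eqn0Ngt fact_gt0.
Qed.

Lemma specht_character_ratio s :
  \tr (specht_repr F la s) / \tr (specht_repr F la 1%g) =
  (\sum_(h : 'S_n) young_coef (h * s^-1 * h^-1)%g) / n`!%:R.
Proof.
have [k k0 tr] := specht_character; rewrite tr.
have -> : n`!%:R = k * \tr (specht_repr F la 1%g).
  rewrite -tr; under eq_bigr do rewrite invg1 mulg1 mulgV young_coef1.
  by rewrite sumr_const card_Sn.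
by rewrite -mulf_div divff // mul1r.
Qed.

End YoungSymmetrizer.

(** * From the character sum to a count of factorizations and labelings *)

Section Bound.
Variables (F : numFieldType) (n : nat) (la : young_diagram n) (s : 'S_n).
Let K := [set x | s x != x].

Lemma perm_on_support : perm_on K s.
Proof. by apply/subsetP=> x; rewrite !inE. Qed.

Lemma row_stabilizerV p : (p^-1%g \in row_stabilizer la) = (p \in row_stabilizer la).
Proof.
apply/row_stabilizerP/row_stabilizerP => h k.
  by rewrite -{2}[k](permK p) h.
by rewrite -{2}[k](permKV p) h.
Qed.

(* A box fixed by [s ^ g] is moved by [t ^ g] inside its column and must be
   moved back inside its row, so [t ^ g] fixes it. *)
Lemma factor_perm_on (t g : 'S_n) : (t ^ g)%g \in column_stabilizer la ->
  ((t^-1 * s) ^ g)%g \in row_stabilizer la -> perm_on K t.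
Proof.
move=> /column_stabilizerP hq /row_stabilizerP hp; apply/subsetP => x; rewrite !inE.
apply: contraNneq => sx; have := hq (g x); have := hp (g (t x)).
rewrite !permJ permM permK sx => er ec.
apply/eqP/(@perm_inj _ g)/(@box_inj _ la); congr (_, _) => //.
Qed.

(** Each [q] determines [p = x * q^-1], so it contributes at most one sign. *)
Lemma norm_young_coef_le x :
  `|young_coef F la x| <=
  #|[set q in column_stabilizer la | (x * q^-1)%g \in row_stabilizer la]|%:R.
Proof.
rewrite /young_coef exchange_big -sum1_card natr_sum big_mkcond [leRHS]big_mkcond /=.
apply: le_trans (ler_norm_sum _ _ _) _; apply: ler_sum => q _; rewrite [in leRHS]in_set.
case: ifP => hq /=; last by rewrite normr0.
case: ifP => hx.
  rewrite (bigD1 (x * q^-1)%g) //= mulgKV eqxx big1 ?addr0 ?normr_sign // => p /andP[_ np].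
  by case: (@eqP _ (p * q)%g x) => // E; case/eqP: np; rewrite -E mulgK.
rewrite big1 ?normr0 // => p hp.
by case: (@eqP _ (p * q)%g x) => // E; move: hx; rewrite -E mulgK hp.
Qed.

Lemma norm_sum_young_coef_le :
  `|\sum_(h : 'S_n) young_coef F la (h * s^-1 * h^-1)%g| <=
  (\sum_(t in Sym K) #|~: K|`! * (num_columns la ^ #|cycles_in K t| *
      num_rows la ^ #|cycles_in K (t^-1 * s)%g|))%N%:R.
Proof.
pose J (t : 'S_n) := [set g : 'S_n | [forall x, (col_of la (g (t x)) == col_of la (g x)) &&
  (row_of la (g ((t^-1 * s)%g x)) == row_of la (g x))]].
apply: (@le_trans _ _ (\sum_(t in Sym K) #|J t|)%N%:R); last first.
  rewrite ler_nat; apply: leq_sum => t; rewrite inE => ht.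
  rewrite -[num_columns la]card_ord -[num_rows la]card_ord.
  apply: card_invariant_labelings => //.
    by move=> k l [er ec]; apply: (@box_inj _ la); congr (_, _); apply: ord_inj.
  by rewrite perm_onM ?perm_onV ?perm_on_support.
(* Double counting of the pairs of a factor [t] and a bijection [g] onto the boxes. *)
have EJ : (\sum_(t in Sym K) #|J t|)%N = (\sum_(g : 'S_n) #|[set t in Sym K | g \in J t]|)%N.
  transitivity (\sum_(t in Sym K) \sum_(g : 'S_n) (g \in J t))%N.
    apply: eq_bigr => t _; rewrite -sum1_card big_mkcond; apply: eq_bigr => g _.
    by case: (g \in _).
  rewrite exchange_big /=; apply: eq_bigr => g _.
  rewrite -sum1_card [RHS](eq_bigl (fun t => (t \in Sym K) && (g \in J t))); last first.
    by move=> t; rewrite inE.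
  by rewrite -big_mkcondr /=; apply: eq_bigr => t _.
rewrite EJ natr_sum (reindex_inj invg_inj) /=.
apply: le_trans (ler_norm_sum _ _ _) _; apply: ler_sum => g _.
apply: le_trans (norm_young_coef_le _) _; rewrite ler_nat invgK.
(* If [g^-1 * s^-1 * g = p * q], then [s = t * u] with [t ^ g = q^-1] and [u ^ g = p^-1]; [f q] is
   this [t]. *)
pose f (q : 'S_n) := ((q^-1) ^ g^-1)%g.
have f_inj : injective f by move=> q q' /conjg_inj/invg_inj.
rewrite -(card_imset _ f_inj); apply/subset_leq_card/subsetP => _ /imsetP[q + ->].
rewrite inE => /andP[hq hp].
have fg : (f q ^ g = q^-1)%g by rewrite conjgKV.
have hq' : (f q ^ g)%g \in column_stabilizer la.
  rewrite fg; move/column_stabilizerP: hq => hq; apply/column_stabilizerP => k.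
  by rewrite -{2}[k](permKV q) hq.
have hp' : (((f q)^-1 * s) ^ g)%g \in row_stabilizer la.
  rewrite conjMg conjVg fg invgK -row_stabilizerV invMg -conjVg.
  by move: hp; rewrite conjgE mulgA.
rewrite !inE (factor_perm_on hq' hp') /=; apply/forallP => x.
move/column_stabilizerP/(_ (g x)): hq'; move/row_stabilizerP/(_ (g x)): hp'.
by rewrite !permJ => -> ->; rewrite !eqxx.
Qed.

End Bound.

(** * Elementary inequalities for powers and factorials *)

Lemma bin_le_exp2 m k : ('C(m, k) <= 2 ^ m)%N.
Proof.
elim: m k => [|m IH] [|k] //; first by rewrite bin0 expn_gt0.
by rewrite binS expnS mul2n -addnn leq_add.
Qed.

(** [k ^ k] is at most the falling factorial [(2 * k) ^_ k], which is [k!] times a binomial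
    coefficient at most [4 ^ k]. *)
Lemma expn_self_le_fact k : (k ^ k <= 4 ^ k * k`!)%N.
Proof.
have le m i : (m ^ i <= (m + i) ^_ i)%N.
  elim: i => // i IH; rewrite addnS ffactSS expnS leq_mul //; lia.
apply: leq_trans (le k k) _; rewrite -bin_ffact leq_mul //.
by rewrite (leq_trans (bin_le_exp2 _ _)) // -[4%N]/(2 ^ 2)%N -expnM mul2n addnn.
Qed.

(** Factor by factor this is [(k - i) / k <= (n - i) / n]. *)
Lemma expn_fact_le_ffact n k : (k <= n -> n ^ k * k`! <= k ^ k * n ^_ k)%N.
Proof.
elim: k n => [|k IH] [|n] //; rewrite ltnS => kn; have {}IH := IH _ kn.
rewrite ffactSS !expnS factS.
have [->|k0] := posnP k; first by rewrite !expn0 ffactn0 fact0; lia.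
suff h : (n.+1 ^ k * k`! <= k.+1 ^ k * n ^_ k)%N.
  by have := leq_mul (leqnn (n.+1 * k.+1)) h; lia.
have kk : (0 < k ^ k)%N by rewrite expn_gt0 k0.
rewrite -(leq_pmul2r kk).
apply: (@leq_trans (k.+1 ^ k * n ^ k * k`!)); last first.
  by rewrite -!mulnA leq_mul2l [(n ^_ k * _)%N]mulnC IH orbT.
rewrite mulnAC leq_mul2r -!expnMn leq_exp2r //; apply/orP; right; nia.
Qed.

Lemma expn_fact_sub_le n k : (k <= n -> n ^ k * (n - k)`! <= 4 ^ k * n`!)%N.
Proof.
move=> kn; rewrite -(leq_pmul2r (fact_gt0 k)) -(ffact_fact kn).
apply: (@leq_trans (k ^ k * n ^_ k * (n - k)`!)).
  by rewrite mulnAC leq_mul2r expn_fact_le_ffact ?orbT.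
have := leq_mul (leqnn (n ^_ k * (n - k)`!)) (expn_self_le_fact k); lia.
Qed.

Lemma exprn_le_max (R : realFieldType) (u : R) d m :
  0 <= u -> (d <= 2 * m)%N -> u ^+ d <= Num.max 1 (u ^+ 2) ^+ m.
Proof.
move=> u0 dm; have M1 : 1 <= Num.max 1 (u ^+ 2) by rewrite le_max lexx.
have [u1|/ltW u1] := leP u 1.
  by apply: le_trans (exprn_ege1 _ M1); rewrite exprn_ile1.
apply: le_trans (ler_weXn2l u1 dm) _; rewrite exprM lerXn2r ?nnegrE //.
- by rewrite exprn_ge0.
- by rewrite (le_trans ler01).
- by rewrite le_max lexx orbT.
Qed.

(** * Weighted count of the factorizations of one permutation *)

Section Estimate.
Variables (R : realFieldType) (n : nat) (s : 'S_n).
Let K := [set x | s x != x].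
Let p := perm_length s.
Hypothesis p_gt0 : (0 < p)%N.

Lemma support_gt0 : (0 < #|K|)%N.
Proof.
rewrite lt0n cards_eq0; apply: contraTneq p_gt0 => K0.
rewrite -leqNgt /p; apply: leq_trans (perm_length_le_cycle_length s) _.
have := perm_on_support s; rewrite -/K K0 => /perm_on_set0 ->.
by rewrite cycle_length1.
Qed.

(** Lets the weight [#|K|^-1 ^+ (2 * p)] absorb the number of all factorizations inside [Sym K]. *)
Lemma fact_support_le : (#|K|`! <= #|K| ^ (2 * p))%N.
Proof.
apply: (@leq_trans (#|K| ^ #|K|)).
  by elim: #|K| => // -[//|k] IH; rewrite factS expnS leq_mul // (leq_trans IH) // leq_exp2r.
by rewrite leq_pexp2l ?support_gt0 ?card_support_le.
Qed.

Lemma cycle_length_factors_ge t : (p <= cycle_length t + cycle_length (t^-1 * s)%g)%N.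
Proof.
rewrite /p -{1}[s](mulKVg t); apply: leq_trans (perm_lengthM _ _) _.
by rewrite leq_add ?perm_length_le_cycle_length.
Qed.

(* Up to length [3 p] the weight [x] is compared with [#|K|^-1]; the remaining
   factorizations are so light that their number [#|K|`!] can be used. *)
Lemma expr_length_le (x : R) r : 0 <= x -> x <= 1 -> (p <= r)%N ->
  x ^+ r <= Num.max 1 ((#|K|%:R * x) ^+ 2) ^+ p * x ^+ p *
            (#|K|%:R ^+ p * #|K|%:R^-1 ^+ r + #|K|%:R^-1 ^+ (2 * p)).
Proof.
move=> x0 x1 pr; set k : R := #|K|%:R; set M := Num.max _ _.
have k0 : 0 < k by rewrite ltr0n support_gt0.
have y0 : 0 <= k^-1 by rewrite invr_ge0 ltW.
have M0 : 0 <= M by rewrite le_max ler01.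
have kx0 : 0 <= k * x by rewrite mulr_ge0 // ltW.
have xE : x = k * x * k^-1 by rewrite mulrAC mulfV ?mul1r // gt_eqF.
(* Beyond [x ^+ p], each factor [x] is written as [k * x] times [k^-1]. [exprn_le_max] bounds up to
   [2 * p] factors [k * x], whence the cut at [3 * p]. *)
have [r3|/ltnW r3] := leqP r (3 * p).
  apply: (@le_trans _ _ (M ^+ p * x ^+ p * (k ^+ p * k^-1 ^+ r))); last first.
    by rewrite ler_wpM2l ?lerDl ?mulr_ge0 ?exprn_ge0.
  have -> : k ^+ p * k^-1 ^+ r = k^-1 ^+ (r - p).
    rewrite -{1}(subnK pr) exprD mulrCA -exprMn mulfV ?gt_eqF // expr1n mulr1 //.
  rewrite -{1}(subnKC pr) exprD mulrAC mulrC ler_wpM2r ?exprn_ge0 //.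
  rewrite {1}xE exprMn ler_wpM2r ?exprn_ge0 // exprn_le_max //; lia.
apply: (@le_trans _ _ (M ^+ p * x ^+ p * k^-1 ^+ (2 * p))); last first.
  by rewrite ler_wpM2l ?lerDr ?mulr_ge0 ?exprn_ge0 // ltW.
apply: le_trans (ler_wiXn2l x0 x1 r3) _.
rewrite mulSn exprD mulrAC mulrC ler_wpM2r ?exprn_ge0 //.
by rewrite {1}xE exprMn ler_wpM2r ?exprn_ge0 // exprn_le_max.
Qed.

Lemma sum_factorizations_estimate (x : R) : 0 <= x -> x <= 1 ->
  \sum_(t in Sym K) x ^+ (cycle_length t + cycle_length (t^-1 * s)%g)
   <= Num.max 1 ((#|K|%:R * x) ^+ 2) ^+ p * x ^+ p * (16 ^+ #|K| + 1).
Proof.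
move=> x0 x1; set k : R := #|K|%:R; set M := Num.max _ _.
have k0 : 0 < k by rewrite ltr0n support_gt0.
have y0 : 0 <= k^-1 by rewrite invr_ge0 ltW.
have M0 : 0 <= M by rewrite le_max ler01.
pose r t := (cycle_length t + cycle_length (t^-1 * s)%g)%N.
apply: le_trans (ler_sum _ (fun t _ => expr_length_le x0 x1 (cycle_length_factors_ge t))) _.
rewrite -/k -/M -mulr_sumr ler_wpM2l ?mulr_ge0 ?exprn_ge0 //.
rewrite big_split /= -mulr_sumr sumr_const card_Sym lerD //; last first.
  rewrite -[leLHS]mulr_natl exprVn ler_pdivrMr ?exprn_gt0 // mul1r.
  by rewrite /k -natrX ler_nat fact_support_le.
have f0 : 0 < #|K|`!%:R :> R by rewrite ltr0n fact_gt0.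
rewrite -(ler_pM2l f0) mulrCA.
apply: le_trans (ler_wpM2l _ (sum_factorizations_le y0 (perm_on_support s))) _.
  by rewrite exprn_ge0 // ltW.
(* At [y = k^-1] the base [1 + k * y] is 2, giving [4 ^ #|K|]. The powers of [k] combine to at most
   [k ^ #|K|], and dividing by the factorial costs another [4 ^ #|K|]. *)
rewrite -/K -/k mulfV ?gt_eqF // natrX mulrA -exprD.
have ks := card_cycles_in (perm_on_support s); rewrite -/K in ks.
have kp : (p + #|cycles_in K s| <= #|K|)%N.
  by have := perm_length_le_cycle_length s; rewrite -/p; lia.
apply: (@le_trans _ _ (k ^+ #|K| * (4 ^+ #|K|))).
  rewrite (_ : 1 + 1 = 2 :> R) // mulnC exprM -natrX.
  rewrite ler_wpM2r ?exprn_ge0 // ler_weXn2l // ler1n support_gt0 //.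
rewrite (_ : 16 = 4 * 4 :> R); last by ring.
rewrite exprMn mulrA ler_wpM2r ?exprn_ge0 //.
by rewrite /k -!natrX -natrM ler_nat mulnC expn_self_le_fact.
Qed.

End Estimate.

(** * Collecting the constants and bounding the character *)

Local Open Scope complex_scope.

(** In use [a] is a number of rows or columns, [m] a number of cycles and [l] a cycle length: each
    unit of length saves a factor [Num.sqrt n]. *)
Lemma labelings_le (R : rcfType) (C : R) (n a m k l : nat) : (0 < n)%N -> 1 <= C ->
    a%:R <= C * Num.sqrt n%:R -> (m + l <= k)%N ->
  (a ^ m)%:R <= C ^+ k * Num.sqrt n%:R ^+ k * (Num.sqrt n%:R)^-1 ^+ l.
Proof.
move=> n0 C1 aC mlk.
have C0 : 0 <= C by apply: le_trans C1.
have s1 : 1 <= Num.sqrt n%:R :> R by rewrite -[leLHS]sqrtr1 ler_wsqrtr ?ler1n.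
have s0 : 0 < Num.sqrt n%:R :> R by apply: lt_le_trans s1.
have sl : (l <= k)%N by apply: leq_trans mlk; rewrite leq_addl.
rewrite natrX -mulrA; apply: (@le_trans _ _ ((C * Num.sqrt n%:R) ^+ m)).
  by rewrite lerXn2r ?nnegrE ?mulr_ge0 // ltW.
have -> : Num.sqrt n%:R ^+ k * (Num.sqrt n%:R)^-1 ^+ l = Num.sqrt n%:R ^+ (k - l) :> R.
  by rewrite -{1}(subnK sl) exprD exprVn mulfK // expf_neq0 // gt_eqF.
rewrite exprMn; apply: ler_pM; rewrite ?exprn_ge0 ?ler_weXn2l //; try lia.
exact: ltW.
Qed.

Lemma character_bound_estimate (R : rcfType) (C : R) (n a b : nat) (s : 'S_n)
    (K := [set x | s x != x]) (p := perm_length s) :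
    (0 < n)%N -> (0 < p)%N -> 1 <= C ->
    a%:R <= C * Num.sqrt n%:R -> b%:R <= C * Num.sqrt n%:R ->
  (\sum_(t in Sym K) #|~: K|`! * (a ^ #|cycles_in K t| *
      b ^ #|cycles_in K (t^-1 * s)%g|))%N%:R / n`!%:R <=
  (4 * (128 * C ^+ 2) ^+ 2 * Num.max 1 (p%:R ^+ 2 / n%:R) / Num.sqrt n%:R) ^+ p.
Proof.
move=> n0 p0 C1 aC bC; set k := #|K|; set q := Num.sqrt n%:R.
have C0 : 0 <= C by apply: le_trans C1.
have s1 : 1 <= q by rewrite -[leLHS]sqrtr1 ler_wsqrtr ?ler1n.
have s0 : 0 < q by apply: lt_le_trans s1.
have x0 : 0 <= q^-1 by rewrite invr_ge0 ltW.
have x1 : q^-1 <= 1 by rewrite invf_le1.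
have qq : q ^+ 2 = n%:R by rewrite sqr_sqrtr.
have [kn cK] : (k <= n)%N /\ #|~: K| = (n - k)%N.
  by have := cardsC K; rewrite card_ord -/k; lia.
have k0 : (0 < k)%N by apply: support_gt0.
have k2p : (k <= 2 * p)%N by apply: card_support_le.
set S := \sum_(t in Sym K) q^-1 ^+ (cycle_length t + cycle_length (t^-1 * s)%g).
have S0 : 0 <= S by apply: sumr_ge0 => t _; rewrite exprn_ge0.
have f0 : 0 < n`!%:R :> R by rewrite ltr0n fact_gt0.
set M := Num.max 1 (p%:R ^+ 2 / n%:R).
have M0 : 0 <= M by rewrite le_max ler01.
(* The two label counts give [C ^+ 2], and [expn_fact_sub_le] gives the 4. *)
apply: (@le_trans _ _ ((4 * C ^+ 2) ^+ k * S)).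
  rewrite ler_pdivrMr //.
  apply: (@le_trans _ _ ((n - k)`!%:R * ((C ^+ 2) ^+ k * n%:R ^+ k * S))).
    rewrite natr_sum mulrA /S mulr_sumr; apply: ler_sum => t; rewrite inE => ht.
    rewrite natrM cK -mulrA ler_wpM2l // natrM.
    have h1 := labelings_le n0 C1 aC (card_cycles_in ht).
    have hu : perm_on K (t^-1 * s)%g by rewrite perm_onM ?perm_onV ?perm_on_support.
    have h2 := labelings_le n0 C1 bC (card_cycles_in hu).
    apply: le_trans (ler_pM _ _ h1 h2) _ => //.
    rewrite -/q -/k -qq exprD (exprAC C) (exprAC q).
    move: (C ^+ k) (q ^+ k) (q^-1 ^+ cycle_length t)
      (q^-1 ^+ cycle_length (t^-1 * s)%g) => c d e e'.
    by rewrite le_eqVlt; apply/orP; left; apply/eqP; ring.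
  have h : n%:R ^+ k * (n - k)`!%:R <= 4 ^+ k * n`!%:R :> R.
    by rewrite -!natrX -!natrM ler_nat expn_fact_sub_le.
  have h' : 0 <= (C ^+ 2) ^+ k * S by rewrite mulr_ge0 ?exprn_ge0.
  have reorder (z y w v u S' : R) : u * z <= v * y -> 0 <= w * S' ->
      z * (w * u * S') <= v * w * S' * y.
    move=> uz wS; rewrite (_ : z * _ = w * S' * (u * z)); last by ring.
    by rewrite (_ : v * w * S' * y = w * S' * (v * y)) ?ler_wpM2l //; ring.
  by rewrite [(4 * _) ^+ k]exprMn; apply: reorder.
have hS := sum_factorizations_estimate p0 x0 x1; rewrite -/K -/k -/p -/S in hS.
(* The factor 4 is the square of the 2 in [k <= 2 * p]. *)
have hM : Num.max 1 ((k%:R * q^-1) ^+ 2) <= 4 * M.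
  rewrite ge_max; apply/andP; split.
    by rewrite -[leLHS]mulr1 ler_pM ?ler1n // le_max lexx.
  apply: (@le_trans _ _ (4 * (p%:R ^+ 2 / n%:R))); last first.
    by rewrite ler_wpM2l // le_max lexx orbT.
  rewrite exprMn exprVn qq mulrA ler_wpM2r ?invr_ge0 //.
  by rewrite -!natrX -natrM ler_nat (_ : 4 = 2 ^ 2)%N // -expnMn leq_exp2r.
have h32 : (16 ^+ k + 1 : R) <= 32 ^+ k.
  have e16 : 1 <= (16 : R) ^+ k by rewrite exprn_ege1 ?ler1n.
  have e2 : 2 <= (2 : R) ^+ k by rewrite -[leLHS]expr1 ler_weXn2l ?ler1n.
  rewrite (_ : 32 = 2 * 16 :> R); last by rewrite -natrM.
  rewrite exprMn.
  by apply: le_trans (ler_wpM2r (ltW (lt_le_trans ltr01 e16)) e2); rewrite mulr_natl mulr2n lerD2l.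
have e4C : 0 <= (4 * C ^+ 2) ^+ k by rewrite !(mulr_ge0, exprn_ge0).
apply: (@le_trans _ _ ((4 * C ^+ 2) ^+ k * ((4 * M) ^+ p * q^-1 ^+ p * 32 ^+ k))).
  rewrite ler_wpM2l //; apply: le_trans hS _.
  apply: ler_pM => //.
  - by rewrite !(mulr_ge0, exprn_ge0) // le_max ler01.
  - by rewrite addr_ge0 // exprn_ge0.
  rewrite ler_wpM2r ?exprn_ge0 // lerXn2r ?nnegrE ?mulr_ge0 //.
  by rewrite le_max ler01.
(* Here 128 is [4 * 32]; its exponent [k] is raised to [2 * p], the base being at least 1. *)
have -> : (4 * (128 * C ^+ 2) ^+ 2 * M / q) ^+ p =
    (128 * C ^+ 2) ^+ (2 * p) * ((4 * M) ^+ p * q^-1 ^+ p).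
  by rewrite exprM -!exprMn; congr (_ ^+ _); ring.
rewrite [leLHS]mulrCA -[X in _ * X]exprMn [leLHS]mulrC.
rewrite (_ : 4 * C ^+ 2 * 32 = 128 * C ^+ 2); last by ring.
rewrite ler_wpM2r //; first by rewrite !(mulr_ge0, exprn_ge0).
apply: ler_weXn2l k2p; rewrite -[leLHS]mulr1 ler_pM ?ler1n //.
by rewrite exprn_ege1.
Qed.

Theorem theorem1 (R : realType) (C : R) (hC : 0 < C) :
  exists D : R,
    forall (n : nat) (la : young_diagram n) (s : 'S_n),
      (1 <= n)%N ->
      (num_rows la)%:R <= C * Num.sqrt n%:R ->
      (num_columns la)%:R <= C * Num.sqrt n%:R ->
      `|normalized_character R la s| <=
        ((D * Num.max 1 ((perm_length s)%:R ^+ 2 / n%:R) / Num.sqrt n%:R)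
           ^+ perm_length s)%:C.
Proof.
(* The estimates require a constant at least 1, so [C] is replaced by [B]. *)
pose B := Num.max 1 C; exists (4 * (128 * B ^+ 2) ^+ 2) => n la s n1 hr hc.
have B1 : 1 <= B by rewrite le_max lexx.
have CB (u : R) : u <= C * Num.sqrt n%:R -> u <= B * Num.sqrt n%:R.
  by move/le_trans; apply; rewrite ler_wpM2r ?sqrtr_ge0 // le_max lexx orbT.
rewrite /normalized_character; have [p0|p0] := posnP (perm_length s).
  have [[|? ?] [//]] := perm_lengthP s; rewrite p0 // => _ _.
  rewrite big_nil => ->; rewrite expr0.
  (* A zero denominator makes the quotient 0, also at most 1. *)
  have [->|t0] := eqVneq (\tr (specht_repr R[i] la 1%g)) 0; first by rewrite mul0r normr0 ler01.
  by rewrite divff // normr1.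
rewrite specht_character_ratio normf_div.
have -> : `|n`!%:R| = n`!%:R :> R[i] by rewrite normr_nat.
apply: le_trans (ler_wpM2r _ (norm_sum_young_coef_le _ _ _)) _; first by rewrite invr_ge0 ler0n.
have := character_bound_estimate n1 p0 B1 (CB _ hc) (CB _ hr).
rewrite -lecR; apply: le_trans; rewrite le_eqVlt; apply/orP; left; apply/eqP.
by rewrite [RHS]rmorphM fmorphV !rmorph_nat.
Qed.
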